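(* Let $A:\mathcal{B}\to\mathbb{R}$ be Lipschitz. Then there exists a strictly positive Lipschitz eigenfunction $\psi_A$ for $\mathcal{L}_A:\mathcal{C}\to\mathcal{C}$ associated to a strictly positive eigenvalue $\lambda_A$ (that is, $\mathcal{L}_A(\psi_A)=\lambda_A\psi_A$). The eigenvalue $\lambda_A$ is simple and it is equal to the spectral radius of $\mathcal{L}_A$.
   Context: $(M,d)$ is a compact connected manifold and $da$ denotes the Lebesgue (normalized volume) probability measure on $M$. $\mathcal{B}=M^{\mathbb{N}}$ is the space of sequences $x=(x_0,x_1,x_2,\dots)$ with $x_i\in M$, with the metric $d(x,y)=\sum_{k\ge 0} d(x_k,y_k)/2^k$. For $a\in M$ and $x\in\mathcal{B}$, $ax=(a,x_0,x_1,\dots)\in\mathcal{B}$. $\mathcal{C}$ is the Banach space of continuous functions $\mathcal{B}\to\mathbb{R}$ with the uniform norm. The Ruelle operator $\mathcal{L}_A:\mathcal{C}\to\mathcal{C}$ is $\mathcal{L}_A(\psi)(x)=\int_M e^{A(ax)}\psi(ax)\,da$. *)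

(* Defs.v *)
From HB Require Import structures.
From mathcomp Require Import all_boot all_order all_algebra.
From mathcomp Require Import all_classical all_reals all_analysis.
From mathcomp Require Import measurable_realfun complex.

Set Implicit Arguments.
Unset Strict Implicit.
Unset Printing Implicit Defensive.

Import Order.TTheory GRing.Theory Num.Theory.
Import numFieldNormedType.Exports.

Local Open Scope classical_set_scope.
Local Open Scope ring_scope.

HB.mixin Record isCompactSpace T & Topological T := {
  compact_setT : compact [set: T]
}.

(* The base point is only there because the generated sigma-algebras of the
   library live on pointed types. *)
#[short(type="compactMetricType")]
HB.structure Definition CompactMetric (R : numDomainType) :=
  { M of Pointed M & Metric R M & isCompactSpace M }.

Definition metric_lipschitz (R : realType) (T : metricType R) (f : T -> R) :=
  exists K : R, forall x y, `|f x - f y| <= K * mdist x y.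

Lemma metric_lipschitz_continuous (R : realType) (T : metricType R)
  (f : T -> R) : metric_lipschitz f -> continuous f.
Proof.
move=> [K fK] x; apply/cvgrPdist_lt => e e0.
have K0 : 0 < `|K| + 1 by rewrite ltr_pwDr.
have : \forall y \near x, ball x (e / (`|K| + 1)) y.
  by apply: nbhsx_ballx; rewrite divr_gt0.
apply: filterS => y; rewrite ballEmdist/= ltr_pdivlMr// mulrC => xy.
apply: le_lt_trans (fK x y) _; apply: le_lt_trans xy.
by rewrite ler_wpM2r ?mdist_ge0// (le_trans (ler_norm _))// lerDl.
Qed.

Definition borel (T : ptopologicalType) := g_sigma_algebraType (@open T).

Definition seqspace (M : Type) := nat -> M.

Definition scons (M : Type) (a : M) (x : seqspace M) : seqspace M :=
  fun k => if k is j.+1 then x j else a.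

Definition seqdist (R : realType) (M : metricType R) (x y : seqspace M) : R :=
  limn (series (fun k => mdist (x k) (y k) / 2 ^+ k)).

Section SeqspaceMetric.
Context (R : realType) (M : compactMetricType R).
Implicit Types x y z : seqspace M.

Let term x y : R^nat := fun k => mdist (x k) (y k) / 2 ^+ k.

Lemma mdist_bounded : exists2 D : R, 0 <= D & forall a b : M, mdist a b <= D.
Proof.
have := @compact_setT R M; rewrite compact_near_coveringP => cov.
have : \forall D \near (+oo : set_system R),
    [set: M] `<=` (fun a => mdist point a <= D).
  apply: cov => a _.
  exists (ball a 1, [set D : R | mdist point a + 1 < D]) => /=.
    split; first exact: (nbhsx_ballx a 1 ltr01).
    by apply: nbhs_pinfty_gt; rewrite num_real.
  move=> [b D] /= [] + aD; rewrite ballEmdist/= => ab.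
  apply: le_trans (ltW aD); apply: le_trans (metric_triangle _ a _) _.
  by rewrite lerD2l ltW.
move=> /(filter_ex) [D bD]; have D0 : 0 <= D.
  exact: le_trans (mdist_ge0 _ _) (bD point I).
exists (D + D) => [|a b]; first exact: addr_ge0.
apply: le_trans (metric_triangle _ point _) _.
by rewrite (metric_sym a) lerD//; exact: bD.
Qed.

Lemma term_ge0 x y k : 0 <= term x y k.
Proof. by rewrite divr_ge0 ?mdist_ge0// exprn_ge0. Qed.

Lemma is_cvg_seqdist x y : cvgn (series (term x y)).
Proof.
have [D D0 bD] := mdist_bounded.
have h : `|2^-1 : R| < 1 by rewrite ger0_norm ?invf_lt1 ?ltr1n.
have cg : cvgn (series (geometric D 2^-1)) by exact: is_cvg_geometric_series.
apply: (@series_le_cvg R (term x y) (geometric D 2^-1) _ _ _ cg) => k.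
- exact: term_ge0.
- by rewrite geometric_ge0.
- by rewrite /geometric/= exprVn ler_pM2r ?bD// invr_gt0 exprn_gt0.
Qed.

Lemma series_le_seqdist x y n : series (term x y) n <= seqdist x y.
Proof.
apply: nondecreasing_cvgn_le; last exact: is_cvg_seqdist.
by apply: nondecreasing_series => k _ _; exact: term_ge0.
Qed.

Lemma seqdist_ge0 x y : 0 <= seqdist x y.
Proof. by have := series_le_seqdist x y 0; rewrite /series/= big_geq. Qed.

Lemma coord_le_seqdist x y k : mdist (x k) (y k) / 2 ^+ k <= seqdist x y.
Proof.
apply: le_trans (series_le_seqdist x y k.+1).
by rewrite /series/= big_nat_recr//= lerDr sumr_ge0// => i _; exact: term_ge0.
Qed.

Lemma seqdistxx x : seqdist x x = 0.
Proof.
rewrite /seqdist (_ : series _ = cst 0) ?lim_cst//.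
by apply/funext => n; rewrite /series/= big1// => i _; rewrite mdistxx mul0r.
Qed.

Lemma seqdist_positivity x y : seqdist x y = 0 -> x = y.
Proof.
move=> xy; apply/funext => k; apply: mdist_positivity; apply/eqP.
rewrite eq_le mdist_ge0 andbT.
by have := coord_le_seqdist x y k; rewrite xy pmulr_lle0// invr_gt0 exprn_gt0.
Qed.

Lemma seqdist_sym x y : seqdist x y = seqdist y x.
Proof.
rewrite /seqdist; congr (limn (series _)).
by apply/funext => k; rewrite metric_sym.
Qed.

Lemma seqdist_triangle y x z : seqdist x z <= seqdist x y + seqdist y z.
Proof.
rewrite /seqdist -lim_seriesD; [|exact: is_cvg_seqdist..].
apply: lim_series_le; first exact: is_cvg_seqdist.
  by apply: is_cvg_seriesD; exact: is_cvg_seqdist.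
move=> k; rewrite /= -mulrDl ler_pM2r ?invr_gt0 ?exprn_gt0//.
exact: metric_triangle.
Qed.

HB.instance Definition _ := gen_eqMixin (seqspace M).
HB.instance Definition _ := gen_choiceMixin (seqspace M).
HB.instance Definition _ := isPointed.Build (seqspace M) (fun=> point).
HB.instance Definition _ := @isMetric.Build R (seqspace M) (@seqdist R M)
  seqdistxx seqdist_positivity seqdist_sym seqdist_triangle.


Lemma seqdist_series_tail (D : R) x y n : (forall a b : M, mdist a b <= D) ->
  seqdist x y <= series (term x y) n + D * 2 / 2 ^+ n.
Proof.
move=> bD; have D0 : 0 <= D := le_trans (mdist_ge0 point point) (bD _ _).
apply: limr_le; first exact: is_cvg_seqdist.
apply: nearW => m; have [mn|nm] := leqP m n.
  rewrite ler_wpDr ?divr_ge0 ?mulr_ge0 ?exprn_ge0//.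
  by apply: nondecreasing_series mn => k _ _; exact: term_ge0.
rewrite /series/= (big_cat_nat _ (ltnW nm))//= lerD2l.
apply: (@le_trans _ _ (\sum_(n <= k < m) D * 2^-1 ^+ k)).
  apply: ler_sum => k _; rewrite exprVn ler_pM2r ?bD//.
rewrite -mulr_sumr -(subnKC (ltnW nm)) geometric_partial_tail.
rewrite geometric_seriesE ?lt_eqF ?invf_lt1 ?ltr1n//=.
rewrite -!mulrA ler_wpM2l// (_ : 1 - 2^-1 = 2^-1 :> R); last first.
  by rewrite {1}[1]splitr mul1r addrK.
rewrite invrK exprVn [leRHS]mulrC ler_pM2l ?invr_gt0 ?exprn_gt0//.
by rewrite ler_piMl// gerBl invr_ge0 exprn_ge0.
Qed.

Let of_ptws (x : {ptws nat -> M}) : seqspace M := x.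

Lemma of_ptws_continuous : continuous of_ptws.
Proof.
move=> x; apply/(@cvg_ballP R (seqspace M) _ (nbhs x) _ of_ptws) => e e0.
have [D D0 bD] := mdist_bounded.
have : (fun n => D * 2 * 2^-1 ^+ n) @ \oo --> (0 : R).
  by apply: (@cvg_geometric _ (D * 2)); rewrite ger0_norm ?invf_lt1 ?ltr1n.
move=> /cvgr_lt /(_ (e / 2)); rewrite divr_gt0// => /(_ isT) [N _ tailN].
have proj k : \forall y \near (x : {ptws nat -> M}),
    mdist (x k) ((y : {ptws nat -> M}) k) < e / 2 / N.+1%:R.
  have /(@cvg_ballP R M _ (nbhs x) _ (@proj nat (fun=> M) k) (x k)) :=
    @proj_continuous nat (fun=> M) k x.
  move=> /(_ (e / 2 / N.+1%:R)); rewrite !divr_gt0// => /(_ isT).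
  by apply: filterS => y; rewrite ballEmdist.
have : \forall y \near x, forall k : 'I_N,
    mdist (x k) ((y : {ptws nat -> M}) k) < e / 2 / N.+1%:R.
  apply: (@filter_forall _ _ (fun (k : 'I_N) (y : {ptws nat -> M}) =>
    mdist (x k) (y k) < e / 2 / N.+1%:R) (nbhs x) (nbhs_filter x)) => k.
  exact: (proj k).
apply: filterS => y xy; rewrite ballEmdist /=.
apply: le_lt_trans (seqdist_series_tail x y N bD) _.
rewrite [e in ltRHS]splitr ler_ltD//; last first.
  by rewrite -exprVn; exact: (tailN N (leqnn N)).
rewrite /series/= big_mkord.
apply: (@le_trans _ _ (\sum_(k < N) (e / 2 / N.+1%:R))).
  apply: ler_sum => k _; apply: le_trans (ltW (xy k)).
  by rewrite ler_pdivrMr ?exprn_gt0// ler_peMr ?mdist_ge0// exprn_ege1// ler1n.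
rewrite sumr_const card_ord -[_ *+ N]mulr_natr mulrAC ler_pdivrMr//.
by rewrite ler_pM2l ?divr_gt0// ler_nat.
Qed.

Lemma seqspace_compact : compact [set: seqspace M].
Proof.
have cT : compact [set: {ptws nat -> M}].
  have := @tychonoff nat (fun=> M) (fun=> setT) (fun=> compact_setT).
  by rewrite (_ : [set f | _] = setT)//; apply/seteqP; split.
have := @continuous_compact _ _ of_ptws setT _ cT.
rewrite (_ : of_ptws @` _ = setT); last first.
  by apply/seteqP; split => // x _; exists x.
apply; apply: continuous_subspaceT; exact: of_ptws_continuous.
Qed.

HB.instance Definition _ := isCompactSpace.Build (seqspace M) seqspace_compact.

Lemma mdist_seqspaceE x y : mdist x y = seqdist x y. Proof. by []. Qed.

Lemma seqdist_scons (a b : M) x y :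
  seqdist (scons a x) (scons b y) = mdist a b + seqdist x y / 2.
Proof.
rewrite [LHS]/seqdist; apply: cvg_lim => //.
rewrite -(@cvg_shiftS _ (series _)).
rewrite (_ : [sequence _]_n = fun n => mdist a b + series (term x y) n / 2).
  by apply: cvgD; [exact: cvg_cst|apply: cvgMl; exact: is_cvg_seqdist].
apply/funext => n; rewrite /series/= big_nat_recl//= expr0 divr1.
rewrite mulr_suml; congr (_ + _); apply: eq_bigr => k _.
by rewrite exprS invfM mulrA -mulrA [2^-1 * _]mulrC mulrA.
Qed.

Lemma scons_continuous :
  continuous (fun ax : M * seqspace M => scons ax.1 ax.2).
Proof.
move=> [a x]; apply/cvg_ballP => e e0.
exists (ball a (e / 2), ball x (e / 2)) => /=.
  by split; apply: nbhsx_ballx; rewrite divr_gt0.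
move=> [b y] /= []; rewrite !ballEmdist/= => ab xy.
rewrite [mdist _ _]seqdist_scons [e]splitr ltrD//.
have {}xy : seqdist x y < e / 2 := xy.
apply: le_lt_trans xy; rewrite ler_pdivrMr//.
by rewrite ler_peMr ?seqdist_ge0// ler1n.
Qed.

End SeqspaceMetric.

Section ContinuousFunctions.
Context (R : realType) (T : compactMetricType R).
Local Notation C := (continuousType T R).
Implicit Types f g h : C.


Let zero_continuous : continuous (fun _ : T => 0 : R).
Proof. by move=> x; exact: cvg_cst. Qed.

Let opp_continuous f : continuous (fun x => - f x).
Proof. by move=> x; apply: cvgN; exact: cts_fun. Qed.

Let add_continuous f g : continuous (fun x => f x + g x).
Proof. by move=> x; apply: cvgD; exact: cts_fun. Qed.

Let scale_continuous (c : R) f : continuous (fun x => c * f x).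
Proof. by move=> x; apply: cvgM; [exact: cvg_cst|exact: cts_fun]. Qed.

Let C0 : C := mkcts zero_continuous.
Let Copp f : C := mkcts (@opp_continuous f).
Let Cadd f g : C := mkcts (@add_continuous f g).
Let Cscale c f : C := mkcts (@scale_continuous c f).

Let CaddA : associative Cadd.
Proof. by move=> f g h; apply/continuousEP => x /=; rewrite /mkcts addrA. Qed.

Let CaddC : commutative Cadd.
Proof. by move=> f g; apply/continuousEP => x /=; rewrite /mkcts addrC. Qed.

Let Cadd0 : left_id C0 Cadd.
Proof. by move=> f; apply/continuousEP => x /=; rewrite /mkcts add0r. Qed.

Let CaddN : left_inverse C0 Copp Cadd.
Proof. by move=> f; apply/continuousEP => x /=; rewrite /mkcts addNr. Qed.

HB.instance Definition _ := GRing.isZmodule.Build C CaddA CaddC Cadd0 CaddN.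

Lemma ctsD f g x : (f + g : C) x = f x + g x. Proof. by []. Qed.

Lemma ctsN f x : (- f : C) x = - f x. Proof. by []. Qed.

Let CscaleA (a b : R) f : Cscale a (Cscale b f) = Cscale (a * b) f.
Proof. by apply/continuousEP => x /=; rewrite /mkcts mulrA. Qed.

Let Cscale1 : left_id 1 Cscale.
Proof. by move=> f; apply/continuousEP => x /=; rewrite /mkcts mul1r. Qed.

Let CscaleDr : right_distributive Cscale +%R.
Proof.
by move=> a f g; apply/continuousEP => x /=; rewrite ctsD /mkcts mulrDr.
Qed.

Let CscaleDl f : {morph Cscale^~ f : a b / a + b}.
Proof.
by move=> a b; apply/continuousEP => x /=; rewrite ctsD /mkcts mulrDl.
Qed.

HB.instance Definition _ := GRing.Zmodule_isLmodule.Build R C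
  CscaleA Cscale1 CscaleDr CscaleDl.

Lemma ctsZ (c : R) f x : (c *: f : C) x = c * f x. Proof. by []. Qed.

Definition supnorm f : R := sup (range (fun x => `|f x|)).

Lemma cts_has_sup f : has_sup (range (fun x => `|f x|)).
Proof.
split; first by exists `|f point|, point.
have [M [_ Mf]] : bounded_set (range f).
  apply: compact_bounded; apply: continuous_compact; last exact: compact_setT.
  by apply: continuous_subspaceT; exact: cts_fun.
exists (M + 1) => _ [x _ <-]; apply: (Mf (M + 1)); first by rewrite ltrDl.
by exists x.
Qed.

Lemma supnorm_ge f x : `|f x| <= supnorm f.
Proof. by apply: sup_upper_bound; [exact: cts_has_sup|exists x]. Qed.

Lemma supnorm_le f (K : R) : (forall x, `|f x| <= K) -> supnorm f <= K.
Proof.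
move=> fK; apply: ge_sup; first by case: (cts_has_sup f).
by move=> _ [x _ <-]; exact: fK.
Qed.

Lemma supnorm_triangle f g : supnorm (f + g) <= supnorm f + supnorm g.
Proof.
apply: supnorm_le => x; rewrite ctsD.
by apply: le_trans (ler_normD _ _) _; rewrite lerD// supnorm_ge.
Qed.

Lemma supnormZ (c : R) f : supnorm (c *: f) = `|c| * supnorm f.
Proof.
have le a h : supnorm (a *: h) <= `|a| * supnorm h.
  by apply: supnorm_le => x; rewrite ctsZ normrM ler_wpM2l// supnorm_ge.
apply/eqP; rewrite eq_le le/=; have [->|c0] := eqVneq c 0.
  rewrite normr0 mul0r; apply: le_trans (supnorm_ge _ point).
  exact: normr_ge0.
rewrite -ler_pdivlMl ?normr_gt0// -normfV.
by have := le c^-1 (c *: f); rewrite scalerA mulVf// scale1r.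
Qed.

Lemma supnorm0_eq0 f : supnorm f = 0 -> f = 0.
Proof.
move=> f0; apply/continuousEP => x; apply/eqP.
by rewrite -normr_le0 -f0 supnorm_ge.
Qed.

HB.instance Definition _ := Lmodule_isNormed.Build R C
  supnorm_triangle supnormZ supnorm0_eq0.

Lemma cts_normE f : `|f| = supnorm f. Proof. by []. Qed.

End ContinuousFunctions.

Section Spectral.
Context (R : realType) (V : normedModType R).
Implicit Types T : V -> V.

(* The operator z - T on the complexification of V, which is encoded as V * V:
   the pair (u, v) is u + i v. *)
Definition complexified_shift T (z : R[i]) (w : V * V) : V * V :=
  (complex.Re z *: w.1 - complex.Im z *: w.2 - T w.1,
   complex.Re z *: w.2 + complex.Im z *: w.1 - T w.2).

Definition resolvent_set T : set R[i] := [set z | exists S : V * V -> V * V,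
  [/\ cancel (complexified_shift T z) S,
      cancel S (complexified_shift T z) &
      exists K : R, forall w, `|S w| <= K * `|w|]].

Definition spectrum T : set R[i] := ~` resolvent_set T.

(* [sup] is 0 on empty or unbounded sets; the spectrum of a bounded operator on
   a nonzero Banach space is neither. *)
Definition spectral_radius T : R := sup [set Normc.normc z | z in spectrum T].

Definition eigenvector T (l : R) (v : V) := v != 0 /\ T v = l *: v.

(* Algebraic multiplicity one: the generalized eigenspace is a line. *)
Definition simple_eigenvalue T (l : R) := exists2 v, eigenvector T l v &
  forall k w, iter k (fun u => T u - l *: u) w = 0 -> exists c : R, w = c *: v.

End Spectral.

Section Smooth.
Context (R : realType) (n : nat).
Implicit Types (U : set 'rV[R]_n).

Fixpoint Ck (k : nat) U (f : 'rV[R]_n -> R) : Prop :=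
  if k is j.+1 then
    forall i : 'I_n, (forall y, U y -> derivable f y (delta_mx 0 i)) /\
                     Ck j U ('D_(delta_mx 0 i) f)
  else forall y, U y -> {for y, continuous f}.

Definition smooth U (f : 'rV[R]_n -> R) := forall k, Ck k U f.

Definition smooth_map U (f : 'rV[R]_n -> 'rV[R]_n) :=
  forall j : 'I_n, smooth U (fun y => f y 0 j).

(* Tangent vectors are rows, hence v is mapped to v *m jacobian_mx f y. *)
Definition jacobian_mx (f : 'rV[R]_n -> 'rV[R]_n) (y : 'rV[R]_n) : 'M[R]_n :=
  \matrix_(i, j) 'D_(delta_mx 0 i) (fun x => f x 0 j) y.

End Smooth.

(* Lebesgue integral over R^n of a nonnegative Borel function, as an iterated
   one-dimensional integral. *)
Fixpoint integral_rV (R : realType) (n : nat) :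
    ('rV[R]_n -> \bar R) -> \bar R :=
  if n is m.+1 then fun f =>
    (\int[@lebesgue_measure R]_t
       integral_rV (fun y : 'rV_m => f (row_mx (t%:M : 'rV_1) y)))%E
  else fun f => f 0.

Record chart (R : realType) (M : ptopologicalType) (n : nat) := Chart {
  chart_dom : set M;
  chart_map : M -> 'rV[R]_n;
  chart_inv : 'rV[R]_n -> M;
  chart_dom_open : open chart_dom;
  chart_img_open : open (chart_map @` chart_dom);
  chart_mapK : forall p, chart_dom p -> chart_inv (chart_map p) = p;
  chart_map_continuous : forall p, chart_dom p -> {for p, continuous chart_map};
  chart_inv_continuous : forall y, (chart_map @` chart_dom) y ->
    {for y, continuous chart_inv}
}.

Definition transition (R : realType) (M : ptopologicalType) (n : nat)
  (c c' : chart R M n) : 'rV[R]_n -> 'rV[R]_n := chart_map c' \o chart_inv c.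

Definition overlap (R : realType) (M : ptopologicalType) (n : nat)
  (c c' : chart R M n) : set 'rV[R]_n :=
  chart_map c @` (chart_dom c `&` chart_dom c').

(* The atlas need not be maximal.  For a chart c of the atlas, [tensor c y] is
   the Gram matrix of the metric tensor in the coordinates y; it is
   unconstrained elsewhere.  When M carries a distance, that distance is only
   tied to the manifold structure through the topology. *)
Record riemannian (R : realType) (M : ptopologicalType) (n : nat) :=
  Riemannian {
  atlas : set (chart R M n);
  tensor : chart R M n -> 'rV[R]_n -> 'M[R]_n;
  atlas_cover : forall p, exists2 c, atlas c & chart_dom c p;
  atlas_smooth : forall c c', atlas c -> atlas c' ->
    smooth_map (overlap c c') (transition c c');
  tensor_smooth : forall c, atlas c -> forall i j,
    smooth (chart_map c @` chart_dom c) (fun y => tensor c y i j);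
  tensor_sym : forall c, atlas c -> forall p, chart_dom c p ->
    (tensor c (chart_map c p))^T = tensor c (chart_map c p);
  tensor_pos : forall c, atlas c -> forall p, chart_dom c p ->
    forall v : 'rV[R]_n, v != 0 ->
    0 < (v *m tensor c (chart_map c p) *m v^T) 0 0;
  tensor_change : forall c c', atlas c -> atlas c' ->
    forall y, overlap c c' y ->
    tensor c y = jacobian_mx (transition c c') y
      *m tensor c' (transition c c' y) *m (jacobian_mx (transition c c') y)^T
}.

Definition is_volume (R : realType) (M : ptopologicalType) (n : nat)
    (g : riemannian R M n) (vol : {measure set (borel M) -> \bar R}) :=
  forall (c : chart R M n) (E : set (borel M)), atlas g c -> measurable E ->
  E `<=` chart_dom c ->
  vol E = integral_rV (fun y => if y \in chart_map c @` E
                                then (Num.sqrt (\det (tensor g c y)))%:E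
                                else 0%E).

Definition is_normalized_volume (R : realType) (M : ptopologicalType) (n : nat)
    (g : riemannian R M n) (mu : probability (borel M) R) :=
  exists2 vol : {measure set (borel M) -> \bar R}, is_volume g vol &
  forall E : set (borel M), measurable E ->
  mu E = ((fine (vol setT))^-1%:E * vol E)%E.

Section ParametricIntegral.
Context (R : realType) (M T : compactMetricType R).
Context (mu : probability (borel M) R) (h : M * T -> R).
Context (ch : continuous h).

Let slice_continuous x : continuous (fun a : M => h (a, x)).
Proof.
move=> a; apply: (@continuous_comp _ _ _ (fun a : M => (a, x)) h).
  move=> P [[U V] /= [Ua Vx] UV]; have Vxx : V x := nbhs_singleton Vx.
  by apply: filterS Ua => b Ub; exact: (UV (b, x) (conj Ub Vxx)).
exact: ch.
Qed.

Lemma slice_integrable x :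
  mu.-integrable [set: borel M] (EFin \o (fun a => h (a, x))).
Proof.
pose f : continuousType M R := mkcts (@slice_continuous x).
have mf : measurable_fun [set: borel M] (fun a => h (a, x)).
  move=> mD; apply: (measurability _ (RGenOInfty.measurableE R)) => //.
  move=> _ [_ [r ->] <-]; rewrite setTI; apply: sub_sigma_algebra.
  by apply: open_comp => [a _|]; [exact: slice_continuous|exact: interval_open].
apply: (@le_integrable _ _ _ mu _ measurableT _ (cst (supnorm f)%:E)).
- exact/measurable_EFinP.
- move=> a _ /=; rewrite lee_fin; apply: le_trans (ler_norm _).
  exact: (supnorm_ge f a).
- exact: finite_measure_integrable_cst.
Qed.

Lemma parametric_integral_continuous :
  continuous (fun x => \int[mu]_(a in [set: borel M]) h (a, x)).
Proof.
move=> x; apply/cvgrPdist_le => e e0.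
have : \forall y \near x, [set: M] `<=`
    (fun a => `|h (a, x) - h (a, y)| <= e).
  have := @compact_setT R M; rewrite compact_near_coveringP => cov.
  apply: cov => a _.
  have /cvgrPdist_lt /(_ (e / 2)) := @ch (a, x).
  rewrite divr_gt0// => /(_ isT) [[P Q] /= [Pa Qx] PQ].
  exists (P, Q) => //= -[b y] /= [Pb Qy].
  have Qxx : Q x := nbhs_singleton Qx.
  have := PQ (b, x) (conj Pb Qxx); have := PQ (b, y) (conj Pb Qy) => /= h1 h2.
  rewrite -(subrK (h (a, x)) (h (b, x))) -addrA.
  apply: le_trans (ler_normD _ _) _.
  by rewrite [e in leRHS]splitr lerD// ltW// distrC.
apply: filterS => y xy.
rewrite -RintegralB//; [|exact: slice_integrable..].
have ixy : mu.-integrable [set: borel M]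
    (EFin \o (fun a => h (a, x) - h (a, y))).
  exact: (integrableB measurableT (slice_integrable x) (slice_integrable y)).
apply: le_trans (le_normr_Rintegral _ ixy) _ => //.
apply: (@le_trans _ _ (\int[mu]_(a in [set: borel M]) e)).
  apply: le_Rintegral => //.
  - exact: integrable_norm ixy.
  - exact: finite_measure_integrable_cst.
by rewrite Rintegral_cst//= probability_setT mulr1.
Qed.

End ParametricIntegral.

Section Ruelle.
Context (R : realType) (M : compactMetricType R).
Context (mu : probability (borel M) R) (A : continuousType (seqspace M) R).
Local Notation C := (continuousType (seqspace M) R).

Definition ruelle_fun (psi : C) (x : seqspace M) : R :=
  \int[mu]_(a in [set: borel M]) (expR (A (scons a x)) * psi (scons a x)).

Lemma ruelle_continuous psi : continuous (ruelle_fun psi).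
Proof.
have ch : continuous (fun y => expR (A y) * psi y).
  have eA : continuous (expR \o A).
    move=> y; apply: continuous_comp; first exact: cts_fun.
    exact: continuous_expR.
  by move=> y; exact: (cvgM (eA y) (@cts_fun _ _ psi y)).
apply: (@parametric_integral_continuous R M (seqspace M) mu
  ((fun y => expR (A y) * psi y) \o (fun ax => scons ax.1 ax.2))).
move=> ax; apply: continuous_comp; first exact: scons_continuous.
exact: ch.
Qed.

Definition ruelle (psi : C) : C := mkcts (@ruelle_continuous psi).

End Ruelle.

(* Main.v *)
Require Import Defs.
From HB Require Import structures.
From mathcomp Require Import all_boot all_order all_algebra.
From mathcomp Require Import all_classical all_reals all_analysis.
From mathcomp Require Import complex ring lra.

(** Write L for the Ruelle operator, X for the sequence space, K for a
    Lipschitz constant of A and d for the distance of X.  Prepending a symbol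
    halves the distance of X, and this contraction carries the whole argument.

    Distortion.  Call f log-Lipschitz when f x <= exp (K d(x,y)) f y.  Passing
    from x to y in the integral defining L f costs K d/2 in the potential A and
    K d/2 in f, hence L preserves this cone with the same K
    ([ruelle_distortion]).  As X is bounded, two values of an element of the
    cone differ by a bounded factor.

    Existence.  With f_n = L^n 1 and a base point o, distortion makes
    n |-> f_n(o) multiplicative up to a constant factor, so by Fekete's argument
    ([almost_multiplicative_growth]) f_n is within bounded factors of l^n for
    some l > 0.  An eigenfunction is then reached by two monotone limits instead
    of a fixed point theorem: G = limsup f_n / l^n satisfies L G >= l G
    ([ruelle_limsup]), so that L^n G / l^n is nondecreasing and bounded, and its
    limit psi satisfies L psi = l psi.  The cone is closed under suprema and
    pointwise limits, so both limits are continuous, and dominated convergence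
    lets L pass to them.

    Simplicity.  A nonnegative eigenfunction f vanishing at one point is zero
    ([nonneg_eigenfunction_eq0]): f is log-Lipschitz at small distances up to an
    error e psi, and iterating L stretches these distances to all of X without
    changing f or the error.  Applied to h - c psi with c = min h / psi, this
    makes the eigenspace a line.  There is no Jordan block either, as it would
    make L^n / l^n grow linearly, whereas |L^n| <= B l^n by comparison with psi.

    Spectral radius.  The bound |L^n| <= B l^n makes the Neumann series
    sum_n z^(-n-1) L^n converge on the complexification when |z| > l, because
    the continuous functions form a complete space; and l itself is in the
    spectrum, being an eigenvalue. *)

Set Implicit Arguments.
Unset Strict Implicit.
Unset Printing Implicit Defensive.

Import Order.TTheory GRing.Theory Num.Theory.
Import numFieldNormedType.Exports.

Local Open Scope classical_set_scope.
Local Open Scope ring_scope.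

(** * Continuous functions on a compact metric space *)

Section CompactMetric.
Context {R : realType} {T : compactMetricType R}.

Lemma compact_argmin (f : T -> R) : continuous f ->
  exists c, forall x, f c <= f x.
Proof.
move=> cf; have [c _ cP] := @compact_EVT_min _ _ f setT (ex_intro _ point I)
  (@compact_setT _ T) (continuous_subspaceT cf).
by exists c => x; apply: cP; rewrite inE.
Qed.

(** The modulus d is found near 0 on the right, uniformly in x by the
    near-covering form of compactness. *)
Lemma compact_uniformly_continuous (f : T -> R) (e : R) : continuous f ->
  0 < e -> exists2 d, 0 < d & forall x y, mdist x y <= d -> f x <= f y + e.
Proof.
move=> cf e0; have := @compact_setT _ T; rewrite compact_near_coveringP => cov.
have : \forall d \near (0 : R)^'+,
    [set: T] `<=` (fun x => forall y, mdist x y <= d -> f x <= f y + e).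
  apply: cov => a _.
  have /cvgrPdist_lt /(_ (e / 2)) := cf a; rewrite divr_gt0// => /(_ isT).
  move=> /nbhs_ballP[r /= r0 rP].
  exists (ball a (r / 2), [set d | d < r / 2]) => /=.
    split; first by apply: nbhsx_ballx; rewrite divr_gt0.
    by apply: nbhs_right_lt; rewrite divr_gt0.
  move=> [x d] /= [+ dr] y xyd; rewrite ballEmdist/= => ax.
  have /rP : ball a r x by rewrite ballEmdist/=; lra.
  have /rP : ball a r y.
    by rewrite ballEmdist/=; have := @metric_triangle _ _ a x y; lra.
  by rewrite /= !ltr_norml => /andP[? ?] /andP[? ?]; lra.
move=> near_d; have : \forall d \near (0 : R)^'+, 0 < d /\
    [set: T] `<=` (fun x => forall y, mdist x y <= d -> f x <= f y + e).
  by apply: filterS2 near_d (nbhs_right_gt 0) => d dP d0; split.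
by move=> /filter_ex[d [d0 dP]]; exists d => // x; exact: dP.
Qed.

End CompactMetric.

(** * Sequences that are multiplicative up to a constant *)

Section AlmostMultiplicative.
Context {R : realType} (F : nat -> R) (c : R).
Hypotheses (c0 : 0 < c) (F0 : forall n, 0 < F n)
  (subF : forall n m, F (n + m)%N <= c * (F n * F m))
  (superF : forall n m, F n * F m <= c * F (n + m)%N).

Let F_mul_le n m : c * F (n * m.+1)%N <= (c * F n) ^+ m.+1.
Proof.
elim: m => [|m IHm]; first by rewrite muln1 expr1.
rewrite mulnS exprS.
apply: (@le_trans _ _ (c * (c * (F n * F (n * m.+1)%N)))).
  by rewrite ler_pM2l.
by rewrite [leLHS](_ : _ = c * F n * (c * F (n * m.+1)%N));
  [rewrite ler_pM2l ?mulr_gt0|ring].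
Qed.

Let F_mul_ge n m : (F n / c) ^+ m.+1 <= F (n * m.+1)%N / c.
Proof.
elim: m => [|m IHm]; first by rewrite muln1 expr1.
rewrite mulnS exprS ler_pdivlMr//.
apply: (@le_trans _ _ (F n / c * (F (n * m.+1)%N / c) * c)).
  by rewrite ler_pM2r// ler_pM2l ?divr_gt0.
rewrite mulrA divfK ?gt_eqF// mulrAC ler_pdivrMr// mulrC.
by rewrite (mulrC (F (n + _)%N)) mulrC.
Qed.

Let F0_le : F 0 <= c.
Proof. by have := superF 0 0; rewrite addn0 ler_pM2r. Qed.

Let F0_ge : 1 <= c * F 0.
Proof.
by have := subF 0 0; rewrite addn0 mulrA -[X in X <= _]mul1r ler_pM2r.
Qed.

Let c1 : 1 <= c.
Proof.
have : 1 <= c * c by apply: le_trans F0_ge _; rewrite ler_pM2l.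
by move: c0; nra.
Qed.

Let ln_cross n m :
  ln (F n.+1 / c) / n.+1%:R <= ln (c * F m.+1) / m.+1%:R.
Proof.
rewrite ler_pdivrMr// mulrAC ler_pdivlMr//.
rewrite !mulr_natr -!lnXn ?mulr_gt0 ?invr_gt0//.
rewrite ler_ln ?posrE ?exprn_gt0 ?mulr_gt0 ?invr_gt0//.
apply: le_trans (F_mul_ge _ _) _; rewrite mulnC; apply: le_trans (F_mul_le _ _).
rewrite ler_pdivrMr// mulrAC ler_peMl ?(ltW (F0 _))//.
by move: c1; nra.
Qed.

(** Fekete's lemma with a two-sided error: [ln (F n / c)] is superadditive and
    [ln (c * F n)] is subadditive, so every quotient [ln (F n / c) / n] lies
    below every [ln (c * F m) / m]; any number separating the two families, here the
    supremum of the first, is [ln l]. *)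
Lemma almost_multiplicative_growth : exists2 l : R, 0 < l &
  forall n, l ^+ n <= c * F n /\ F n <= c * l ^+ n.
Proof.
pose S := range (fun n => ln (F n.+1 / c) / n.+1%:R).
have supS : has_sup S.
  split; first by exists (ln (F 1 / c) / 1); exists 0.
  by exists (ln (c * F 1) / 1) => _ [n _ <-]; exact: ln_cross.
exists (expR (sup S)); first exact: expR_gt0.
case=> [|n]; first by rewrite expr0 mulr1.
rewrite -expRM_natl; split.
  rewrite -[leRHS]lnK ?posrE ?mulr_gt0// ler_expR mulrC -ler_pdivlMr//.
  by apply: ge_sup => [|_ [m _ <-]]; [case: supS|exact: ln_cross].
rewrite -ler_pdivrMl// mulrC -[leLHS]lnK ?posrE ?divr_gt0// ler_expR.
rewrite -ler_pdivrMl// mulrC.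
by apply: sup_upper_bound => //; exists n => //;
  rewrite [LHS]mulrC [F _ / c]mulrC.
Qed.

End AlmostMultiplicative.

(** * Log-Lipschitz functions *)

Section LogLipschitz.
Context {R : realType} {T : compactMetricType R}.

(** Stated without logarithms, which makes closure under suprema and pointwise
    limits immediate. *)
Definition log_lipschitz (K : R) (f : T -> R) :=
  forall x y, f x <= expR (K * mdist x y) * f y.

Lemma log_lipschitzZ (K c : R) (f : T -> R) : 0 <= c ->
  log_lipschitz K f -> log_lipschitz K (fun x => c * f x).
Proof. by move=> c0 Kf x y; rewrite mulrCA ler_wpM2l. Qed.

Lemma log_lipschitz_cvg (K : R) (u : nat -> T -> R) (v : T -> R) :
  (forall n, log_lipschitz K (u n)) -> (forall x, u ^~ x @ \oo --> v x) ->
  log_lipschitz K v.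
Proof.
move=> Ku uv x y; apply: (ler_cvg_to (uv x) (cvgM (cvg_cst _) (uv y))).
by apply: nearW => n; exact: Ku.
Qed.

(** From [1 - exp (- t) <= t]: the increment [f u - f v] is at most
    [f u * (1 - exp (- K d(u,v)))]. *)
Lemma log_lipschitz_metric_lipschitz (K b : R) (f : T -> R) :
  0 <= K -> (forall x, 0 <= f x <= b) -> log_lipschitz K f ->
  metric_lipschitz f.
Proof.
move=> K0 fb Kf; exists (b * K) => x y.
have dif u v : f u - f v <= b * K * mdist u v.
  have /andP[fu0 fub] := fb u.
  have fuv : expR (- (K * mdist u v)) * f u <= f v.
    by rewrite expRN ler_pdivrMl ?expR_gt0.
  have t0 : 0 <= K * mdist u v by rewrite mulr_ge0 ?mdist_ge0.
  have := expR_ge1Dx (- (K * mdist u v)).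
  rewrite -mulrA; move: (K * _) (expR _) t0 fuv => t e t0 fuv te.
  have : 0 <= (b - f u) * t by rewrite mulr_ge0 ?subr_ge0.
  have : 0 <= f u * (e - (1 - t)) by rewrite mulr_ge0 ?subr_ge0.
  by move: fuv; rewrite mulrC; lra.
by rewrite ler_norml dif andbT lerNl opprB (metric_sym x).
Qed.

End LogLipschitz.

(** * Linearity, positivity and continuity of the Ruelle operator *)

Section RuelleBasics.
Context {R : realType} {M : compactMetricType R}.
Context (mu : probability (borel M) R) (A : continuousType (seqspace M) R).
Local Notation C := (continuousType (seqspace M) R).
Local Notation L := (ruelle mu A).
Implicit Types f g : C.

Lemma expR_comp_continuous : continuous (expR \o A).
Proof.
by move=> y; apply: continuous_comp; [exact: cts_fun|exact: continuous_expR].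
Qed.

Lemma expR_mul_continuous f : continuous (fun y => expR (A y) * f y).
Proof.
by move=> y; exact: (cvgM (@expR_comp_continuous y) (@cts_fun _ _ f y)).
Qed.

Lemma ruelle_integrable f x : mu.-integrable [set: borel M]
  (EFin \o (fun a => expR (A (scons a x)) * f (scons a x))).
Proof.
apply: (@slice_integrable R M (seqspace M) mu
  ((fun y => expR (A y) * f y) \o (fun ax => scons ax.1 ax.2))) => ax.
apply: continuous_comp; first exact: scons_continuous.
exact: expR_mul_continuous.
Qed.

Lemma ruelle_is_linear : linear L.
Proof.
move=> c f g; apply/continuousEP => x.
rewrite ctsD ctsZ /= /mkcts /ruelle_fun -RintegralZl//; last first.
  exact: ruelle_integrable.
rewrite -RintegralD//; last exact: ruelle_integrable.
  by apply: eq_Rintegral => a _; rewrite ctsD ctsZ; ring.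
have := ruelle_integrable (c *: f) x; congr (_.-integrable _ _).
by apply/funext => a /=; rewrite ctsZ; congr EFin; ring.
Qed.

HB.instance Definition _ := GRing.isLinear.Build R C C *:%R L ruelle_is_linear.

(** Comparing the integrands over the same symbol a allows different base points
    x and y on the two sides; distortion estimates need this. *)
Lemma ruelle_le f g x y :
  (forall a, expR (A (scons a x)) * f (scons a x) <=
             expR (A (scons a y)) * g (scons a y)) -> L f x <= L g y.
Proof.
move=> fg; rewrite /= /mkcts /ruelle_fun.
by apply: le_Rintegral => //; exact: ruelle_integrable.
Qed.

Lemma ler_ruelle f g : (forall x, f x <= g x) -> forall x, L f x <= L g x.
Proof. by move=> fg x; apply: ruelle_le => a; rewrite ler_pM2l ?expR_gt0. Qed.

Lemma ler_iter_ruelle n f g : (forall x, f x <= g x) ->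
  forall x, iter n L f x <= iter n L g x.
Proof. by move=> fg; elim: n => //= n IHn x; exact: ler_ruelle. Qed.

Lemma ruelle_gt0 f : (forall x, 0 < f x) -> forall x, 0 < L f x.
Proof.
move=> f0 x; pose e y := expR (A y) * f y.
have [c cP] := compact_argmin (@expR_mul_continuous f).
have e0 : 0 < e c by rewrite /e mulr_gt0 ?expR_gt0.
apply: (@lt_le_trans _ _ (\int[mu]_(a in [set: borel M]) e c)).
  by rewrite Rintegral_cst//= probability_setT mulr1.
apply: le_Rintegral => //.
- exact: finite_measure_integrable_cst.
- exact: ruelle_integrable.
- by move=> a _; exact: cP.
Qed.

Lemma ruelle_cvg (u : nat -> C) (v : C) (b : R) :
  (forall n x, `|u n x| <= b) -> (forall x, u ^~ x @ \oo --> v x) ->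
  forall x, (fun n => L (u n) x) @ \oo --> L v x.
Proof.
move=> ub uv x; rewrite /= /mkcts /ruelle_fun /Rintegral.
have mE f := measurable_int mu (ruelle_integrable f x).
apply: fine_cvg; rewrite fineK; last first.
  exact: integrable_fin_num (ruelle_integrable v x).
have ae_cvg : {ae mu, forall a, [set: borel M] a ->
    (fun n => (expR (A (scons a x)) * u n (scons a x))%:E) @ \oo -->
    (expR (A (scons a x)) * v (scons a x))%:E}.
  apply: aeW => a _; apply: cvg_EFin; first exact: nearW.
  by apply: cvgM; [exact: cvg_cst|exact: uv].
have ae_le : {ae mu, forall a n, [set: borel M] a ->
    (`|(expR (A (scons a x)) * u n (scons a x))%:E| <=
     (expR (supnorm A) * b)%:E)%E}.
  apply: aeW => a n _; rewrite lee_fin normrM ler_pM//.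
  rewrite ger0_norm ?expR_ge0// ler_expR.
  exact: le_trans (ler_norm _) (supnorm_ge A _).
have [_ _] := @dominated_convergence _ _ _ mu _ measurableT _ _
  (EFin \o cst (expR (supnorm A) * b)) (fun n => mE (u n)) (mE v) ae_cvg
  (@finite_measure_integrable_cst _ _ _ _ _ _ measurableT) ae_le.
exact.
Qed.

End RuelleBasics.

(** * Existence of a positive eigenfunction *)

Section Existence.
Context {R : realType} {M : compactMetricType R}.
Context (mu : probability (borel M) R) (A : continuousType (seqspace M) R).
Context {K : R} (K0 : 0 <= K)
  (AK : forall x y, `|A x - A y| <= K * mdist x y).
Local Notation X := (seqspace M).
Local Notation C := (continuousType (seqspace M) R).
Local Notation L := (ruelle mu A).
Implicit Types f g : C.

Lemma mdist_scons (a : M) (x y : X) :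
  mdist (scons a x) (scons a y) = mdist x y / 2.
Proof. by rewrite [LHS]seqdist_scons mdistxx add0r. Qed.

(** The distance of the preimages is half that of x and y, so the potential and
    the function f contribute [K d / 2] each: the constant K is reproduced. *)
Lemma ruelle_distortion f g x y : (forall z, 0 <= g z) ->
  (forall a, f (scons a x) <=
             expR (K * (mdist x y / 2)) * g (scons a y)) ->
  L f x <= expR (K * mdist x y) * L g y.
Proof.
move=> g0 fg; rewrite -[leRHS]/((_ *: L g : C) y) -linearZ.
apply: ruelle_le => a; rewrite ctsZ.
apply: (@le_trans _ _ (expR (A (scons a x)) *
    (expR (K * (mdist x y / 2)) * g (scons a y)))).
  by rewrite ler_pM2l ?expR_gt0.
rewrite !mulrA ler_wpM2r// -!expRD ler_expR.
have := AK (scons a x) (scons a y); rewrite mdist_scons ler_norml => /andP[_].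
lra.
Qed.

Lemma iter_ruelle_ge0 f n : (forall x, 0 <= f x) ->
  forall x, 0 <= iter n L f x.
Proof.
move=> f0 x; have L0 k : iter k L 0 = 0 :> C.
  by elim: k => //= k ->; rewrite linear0.
by rewrite -[0]/((0 : C) x) -(L0 n); exact: ler_iter_ruelle.
Qed.

(** Local distortion becomes global under iteration: a comparison of f and g at
    distance at most d is inherited by [L^n f] and [L^n g] at distance at most
    [2^n d]. *)
Lemma iter_ruelle_distortion f g (d : R) : (forall x, 0 <= g x) ->
  (forall x y, mdist x y <= d -> f x <= expR (K * mdist x y) * g y) ->
  forall n x y, mdist x y <= 2 ^+ n * d ->
    iter n L f x <= expR (K * mdist x y) * iter n L g y.
Proof.
move=> g0 fg; elim=> [|n IHn] x y; first by rewrite expr0 mul1r; exact: fg.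
rewrite exprS -mulrA mulrC -ler_pdivrMr// => xyd /=.
apply: ruelle_distortion => [|a]; first exact: iter_ruelle_ge0.
by have := IHn (scons a x) (scons a y); rewrite mdist_scons; exact.
Qed.

Lemma log_lipschitz_iter_ruelle f n : (forall x, 0 <= f x) ->
  log_lipschitz K f -> log_lipschitz K (iter n L f).
Proof.
move=> f0 Kf x y; apply: (@iter_ruelle_distortion _ _ (mdist x y)) => //.
by rewrite ler_peMl ?mdist_ge0// exprn_ege1// ler1n.
Qed.

Lemma iter_ruelleZ n c f : iter n L (c *: f) = c *: iter n L f.
Proof. by elim: n => //= n ->; rewrite linearZ. Qed.

(** On the cone, bounded pointwise limits stay continuous, so L can be applied
    to them, and L commutes with them by dominated convergence. *)
Lemma log_lipschitz_limit (u : nat -> C) (b : R) :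
  (forall n, log_lipschitz K (u n)) -> (forall n x, 0 <= u n x <= b) ->
  (forall x, cvgn (u ^~ x)) ->
  exists v : C, [/\ log_lipschitz K v, forall x, u ^~ x @ \oo --> v x &
    forall x, (fun n => L (u n) x) @ \oo --> L v x].
Proof.
move=> Ku ub uc; pose w x := limn (u ^~ x).
have uw x : u ^~ x @ \oo --> w x by exact: uc.
have Kw : log_lipschitz K w by exact: log_lipschitz_cvg uw.
have wb x : 0 <= w x <= b.
  apply/andP; split.
    by apply: limr_ge => //; apply: nearW => n; have /andP[] := ub n x.
  by apply: limr_le => //; apply: nearW => n; have /andP[] := ub n x.
have cw := metric_lipschitz_continuous
  (log_lipschitz_metric_lipschitz K0 wb Kw).
exists (mkcts cw); split => //; apply: (@ruelle_cvg _ _ _ _ _ _ b) => // n x.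
by have /andP[? ?] := ub n x; rewrite ger0_norm.
Qed.

Let one : C := mkcts (@cst_continuous X R 1).

Let one_ge0 x : 0 <= one x. Proof. exact: ler01. Qed.

Let log_lipschitz_one : log_lipschitz K one.
Proof.
move=> x y; rewrite -[one x]/1 -[one y]/1 mulr1 -[leLHS]expR0 ler_expR.
by rewrite mulr_ge0 ?mdist_ge0.
Qed.

(** Comparing [L^n 1] with constants at the base point gives
    [L^(n+m) 1 ~ L^n 1 * L^m 1] up to the distortion factor, which produces l. *)
Lemma ruelle_growth : exists l c : R, [/\ 0 < l, 0 < c &
  forall n x, c^-1 <= (l ^- n *: iter n L one) x <= c].
Proof.
have [D D0 bD] := @mdist_bounded R X.
pose f n := iter n L one; pose F n := f n point; pose c := expR (K * D).
have Kf n : log_lipschitz K (f n).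
  exact: log_lipschitz_iter_ruelle.
have f0 n x : 0 < f n x.
  by elim: n x => [|n IHn] x; [exact: ltr01|exact: ruelle_gt0].
have fc n x y : f n x <= c * f n y.
  by apply: le_trans (Kf n x y) _; rewrite ler_pM2r// ler_expR ler_wpM2l.
have fD n m : f (n + m)%N = iter m L (f n) by rewrite /f addnC iterD.
have fZ r m x : iter m L (r *: one) x = r * f m x by rewrite iter_ruelleZ.
have c0 : 0 < c by exact: expR_gt0.
have [|n m|n m|l l0 lF] := @almost_multiplicative_growth R F c c0.
- by move=> n; exact: f0.
- rewrite mulrA -fZ /F fD; apply: ler_iter_ruelle => x.
  by rewrite ctsZ -[one x]/1 mulr1.
- rewrite -fZ /F fD -[leRHS]/((c *: _ : C) point) -iter_ruelleZ.
  apply: ler_iter_ruelle => x; rewrite !ctsZ -[one x]/1 mulr1.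
  by exact: fc.
exists l, (c * c); split; rewrite ?mulr_gt0// => n x.
have ln0 : 0 < l ^+ n by rewrite exprn_gt0.
have [h1 h2] := lF n.
rewrite ctsZ -/(f n x); apply/andP; split.
  rewrite [leRHS]mulrC ler_pdivlMr// ler_pdivrMl ?mulr_gt0//.
  by apply: le_trans h1 _; rewrite -mulrA ler_pM2l//; exact: fc.
rewrite ler_pdivrMl// mulrC -mulrA; apply: le_trans (fc n x point) _.
by rewrite ler_pM2l.
Qed.

(** [L (sup_(n >= k) h n) >= sup_(n >= k) L (h n) = l * sup_(n > k) h n] by
    positivity of L; then let k go to infinity. *)
Lemma ruelle_limsup (h : nat -> C) (l c : R) : 0 < c -> 0 < l ->
  (forall n, log_lipschitz K (h n)) ->
  (forall n x, c^-1 <= h n x <= c) ->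
  (forall n, L (h n) = l *: h n.+1) ->
  exists G : C, [/\ log_lipschitz K G, forall x, c^-1 <= G x <= c &
    forall x, l * G x <= L G x].
Proof.
move=> c0 l0 Kh hc hS; pose g k x := sups (h ^~ x) k.
have ub x : has_ubound (range (h ^~ x)).
  by exists c => _ [n _ <-]; have /andP[] := hc n x.
have lb x : has_lbound (range (h ^~ x)).
  by exists c^-1 => _ [n _ <-]; have /andP[] := hc n x.
have hg k n x : (k <= n)%N -> h n x <= g k x.
  by move=> kn; apply: ub_le_sup; [exact/has_ubound_sdrop|exists n].
have gle k x b : (forall n, (k <= n)%N -> h n x <= b) -> g k x <= b.
  move=> hb; apply: ge_sup => [|_ [n /= kn <-]]; last exact: hb.
  by exists (h k x), k => /=.
have Kg k : log_lipschitz K (g k).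
  move=> x y; apply: gle => n kn; apply: le_trans (Kh n x y) _.
  by rewrite ler_pM2l ?expR_gt0// hg.
have gc k x : c^-1 <= g k x <= c.
  apply/andP; split; last by apply: gle => n _; have /andP[] := hc n x.
  by apply: le_trans (hg k k x (leqnn k)); have /andP[] := hc k x.
have gb k x : 0 <= g k x <= c.
  by have /andP[g1 ->] := gc k x; rewrite (le_trans _ g1)// invr_ge0 ltW.
pose u k : C := mkcts (metric_lipschitz_continuous
  (log_lipschitz_metric_lipschitz K0 (gb k) (Kg k))).
have ucvg x : cvgn (u ^~ x).
  by apply/cvg_ex; exists (inf (range (sups (h ^~ x)))); exact: cvg_sups_inf.
have [G [KG uG LG]] := @log_lipschitz_limit u c Kg gb ucvg.
exists G; split => // x.
  apply/andP; split.
    apply: (ler_cvg_to (cvg_cst _) (uG x)); apply: nearW => k.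
    by have /andP[] := gc k x.
  apply: (ler_cvg_to (uG x) (cvg_cst _)); apply: nearW => k.
  by have /andP[] := gc k x.
have uGS : (fun k => u k.+1 x) @ \oo --> G x.
  by have := uG x; rewrite -(@cvg_shiftS _ (u ^~ x)).
apply: (ler_cvg_to (cvgM (cvg_cst l) uGS) (LG x)).
apply: nearW => k /=; rewrite mulrC -ler_pdivlMr//; apply: gle => -[//|n] kn.
rewrite ler_pdivlMr// mulrC -[leLHS]/((l *: h n.+1 : C) x) -hS.
by apply: ler_ruelle => y; exact: hg.
Qed.

(** The subsolution G is increased by [L / l] and stays bounded, so iterating
    [L / l] from G converges monotonically to a fixed point of [L / l]. *)
Theorem exists_positive_eigenfunction : exists (psi : C) (l : R),
  [/\ log_lipschitz K psi, forall x, 0 < psi x, 0 < l & L psi = l *: psi].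
Proof.
have [l [c [l0 c0 lc]]] := ruelle_growth.
have [||G [KG Gc LG]] :=
  @ruelle_limsup (fun n => l ^- n *: iter n L one) l c c0 l0 _ lc.
- move=> n; apply: log_lipschitzZ; first by rewrite invr_ge0 exprn_ge0// ltW.
  exact: log_lipschitz_iter_ruelle.
- move=> n; rewrite linearZ scalerA exprS invfM mulrA divff ?gt_eqF// mul1r.
  by [].
have G0 x : 0 < G x.
  by have /andP[+ _] := Gc x; apply: lt_le_trans; rewrite invr_gt0.
pose u n : C := l ^- n *: iter n L G.
have uS n : L (u n) = l *: u n.+1.
  by rewrite linearZ scalerA exprS invfM mulrA divff ?gt_eqF// mul1r.
have Ku n : log_lipschitz K (u n).
  apply: log_lipschitzZ; first by rewrite invr_ge0 exprn_ge0// ltW.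
  by apply: log_lipschitz_iter_ruelle => // x; exact: ltW.
have uleS n x : u n x <= u n.+1 x.
  rewrite -(ler_pM2l l0) -[leRHS]/((l *: u n.+1 : C) x) -uS linearZ.
  rewrite /u -[leLHS]/((l *: (l ^- n *: iter n L G)) x) scalerA mulrC -scalerA.
  rewrite -iter_ruelleZ -iterS iterSr !ctsZ ler_pM2l ?invr_gt0 ?exprn_gt0//.
  by apply: ler_iter_ruelle => y; rewrite ctsZ.
have undec x : nondecreasing_seq (u ^~ x) by apply/nondecreasing_seqP.
have ub n x : 0 <= u n x <= c * c.
  apply/andP; split.
    apply: le_trans (ltW (G0 x)) _.
    by have := undec x 0%N n (leq0n n); rewrite {1}/u ctsZ expr0 invr1 mul1r.
  apply: (@le_trans _ _ ((l ^- n *: iter n L (c *: one) : C) x)).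
    rewrite !ctsZ ler_pM2l ?invr_gt0 ?exprn_gt0//; apply: ler_iter_ruelle => y.
    by rewrite ctsZ -[one y]/1 mulr1; have /andP[] := Gc y.
  rewrite iter_ruelleZ scalerA mulrC -scalerA ctsZ ler_pM2l//.
  by have /andP[] := lc n x.
have ucvg x : cvgn (u ^~ x).
  apply: nondecreasing_is_cvgn => //; exists (c * c) => _ [n _ <-].
  by have /andP[] := ub n x.
have [psi [Kpsi upsi Lpsi]] := @log_lipschitz_limit u (c * c) Ku ub ucvg.
exists psi, l; split => // [x|].
  apply: lt_le_trans (G0 x) _.
  have := nondecreasing_cvgn_le (undec x) (ucvg x) 0%N.
  by rewrite {1}/u ctsZ expr0 invr1 mul1r (cvg_lim _ (upsi x)).
apply/continuousEP => x; rewrite ctsZ.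
have uSpsi : (fun k => u k.+1 x) @ \oo --> psi x.
  by have := upsi x; rewrite -(@cvg_shiftS _ (u ^~ x)).
have LuS : (fun n => L (u n) x) = (fun n => l * u n.+1 x).
  by apply/funext => n; rewrite uS ctsZ.
have := Lpsi x; rewrite LuS => Lupsi.
exact: (cvg_unique _ Lupsi (cvgM (cvg_cst l) uSpsi)).
Qed.

End Existence.

(** * Simplicity of the eigenvalue *)

Section Uniqueness.
Context {R : realType} {M : compactMetricType R}.
Context (mu : probability (borel M) R) (A : continuousType (seqspace M) R).
Context {K : R} (K0 : 0 <= K)
  (AK : forall x y, `|A x - A y| <= K * mdist x y).
Local Notation X := (seqspace M).
Local Notation C := (continuousType (seqspace M) R).
Local Notation L := (ruelle mu A).
Context (psi : C) (l : R) (psi0 : forall x, 0 < psi x) (l0 : 0 < l)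
  (Lpsi : L psi = l *: psi).
Implicit Types f g : C.

Lemma iter_ruelle_eigen n f : L f = l *: f -> iter n L f = l ^+ n *: f.
Proof.
move=> Lf; elim: n => [|n IHn]; first by rewrite scale1r.
by rewrite iterS IHn linearZ/= Lf scalerA exprSr.
Qed.

(** By uniform continuity [f u <= f v + e' psi v] for u and v close to each
    other.  Both f and [f + e' psi] are eigenfunctions for l, so iterating L
    extends this, up to the distortion factor, to the given points: [f x <= k e']
    with k independent of e'. *)
Lemma nonneg_eigenfunction_eq0 f : (forall x, 0 <= f x) -> L f = l *: f ->
  forall y, f y = 0 -> f = 0.
Proof.
move=> f0 Lf y fy; have [a aP] := compact_argmin (@cts_fun _ _ psi).
apply/continuousEP => x; apply/eqP; rewrite eq_le f0 andbT -[(0 : C) x]/0.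
pose k := expR (K * mdist x y) * psi y.
have k0 : 0 < k by rewrite mulr_gt0 ?expR_gt0.
apply/ler_addgt0Pr => _ /posnumP[e]; rewrite add0r.
(* so that the error e' psi, once distorted, is exactly e *)
pose e' := e%:num / k; have e'0 : 0 < e' by rewrite divr_gt0.
have [d d0 dP] : exists2 d, 0 < d &
    forall x y, mdist x y <= d -> f x <= f y + e' * psi a.
  by apply: compact_uniformly_continuous; [exact: cts_fun|exact: mulr_gt0].
pose g : C := f + e' *: psi.
have Lg : L g = l *: g.
  by rewrite linearD linearZ/= Lf Lpsi scalerDr !scalerA mulrC.
have g0 z : 0 <= g z by rewrite ctsD addr_ge0// ctsZ mulr_ge0 ?ltW.
have fg u v : mdist u v <= d -> f u <= expR (K * mdist u v) * g v.
  move=> /dP uv; apply: le_trans uv _.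
  apply: (@le_trans _ _ (g v)).
    by rewrite ctsD ctsZ lerD2l ler_pM2l.
  by rewrite ler_peMl// -[leLHS]expR0 ler_expR mulr_ge0 ?mdist_ge0.
have [n xyn] : exists n, mdist x y <= 2 ^+ n * d.
  exists (Num.bound (mdist x y / d)); rewrite -ler_pdivrMr//.
  apply: le_trans (ltW (archi_boundP _)) _.
    by rewrite divr_ge0 ?mdist_ge0 ?ltW.
  by rewrite -natrX ler_nat ltnW// ltn_expl.
have := iter_ruelle_distortion mu AK g0 fg xyn.
rewrite (iter_ruelle_eigen _ Lf) (iter_ruelle_eigen _ Lg) !ctsZ mulrCA.
rewrite ler_pM2l ?exprn_gt0// => /le_trans; apply.
by rewrite ctsD ctsZ fy add0r mulrCA /e' divfK ?gt_eqF.
Qed.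

(** With c the minimum of [f / psi], [f - c psi] is nonnegative and has a zero. *)
Lemma eigenspace_line f : L f = l *: f -> exists c, f = c *: psi.
Proof.
move=> Lf.
have [a aP] : exists a, forall x, f a / psi a <= f x / psi x.
  apply: (@compact_argmin _ X) => x.
  have p0 : psi x != 0 by rewrite gt_eqF.
  exact: (cvgM (@cts_fun _ _ f x) (cvgV p0 (@cts_fun _ _ psi x))).
exists (f a / psi a); apply/eqP; rewrite -subr_eq0; apply/eqP.
apply: (@nonneg_eigenfunction_eq0 _ _ _ a) => [x||].
- by rewrite ctsD ctsN ctsZ subr_ge0 -ler_pdivlMr.
- by rewrite linearB linearZ/= Lf Lpsi scalerBr !scalerA mulrC.
- by rewrite ctsD ctsN ctsZ divfK ?gt_eqF// subrr.
Qed.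

(** Positivity of L turns [|f| <= c psi] into [|L^n f| <= c l^n psi]. *)
Lemma iter_ruelle_bound : exists2 B : R, 0 <= B &
  forall n f, `|iter n L f| <= B * l ^+ n * `|f|.
Proof.
have [a aP] := compact_argmin (@cts_fun _ _ psi).
exists (`|psi| / psi a); first by rewrite divr_ge0// ltW.
move=> n f; rewrite cts_normE; apply: supnorm_le => x.
pose c : R := `|f| / psi a.
have le_iter g : (forall y, `|g y| <= `|f|) ->
    iter n L g x <= l ^+ n * (c * psi x).
  move=> gf; rewrite mulrCA -[leRHS]/((c *: (l ^+ n *: psi)) x).
  rewrite -(iter_ruelle_eigen _ Lpsi) -iter_ruelleZ.
  apply: ler_iter_ruelle => y; apply: le_trans (ler_norm _) _.
  apply: le_trans (gf y) _; rewrite ctsZ /c mulrAC ler_pdivlMr//.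
  by rewrite ler_wpM2l.
have fle y : `|f y| <= `|f| by exact: supnorm_ge.
apply: (@le_trans _ _ (l ^+ n * (c * psi x))).
  rewrite ler_norml le_iter// andbT lerNl -[- _]/((- iter n L f) x).
  rewrite -scaleN1r -iter_ruelleZ; apply: le_iter => y.
  by rewrite ctsZ mulN1r normrN.
rewrite [leRHS](_ : _ = l ^+ n * (c * `|psi|)); last by rewrite /c; ring.
rewrite ler_wpM2l ?exprn_ge0 ?(ltW l0)// ler_wpM2l ?divr_ge0 ?(ltW (psi0 _))//.
by apply: le_trans (ler_norm _) (supnorm_ge _ _).
Qed.

(** It is enough to exclude [L f = l f + c psi] with c nonzero: then
    [L^n f = l^n (f + n (c / l) psi)], which outgrows the bound [B l^n]. *)
Lemma generalized_eigenspace_line k f :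
  iter k (fun u => L u - l *: u) f = 0 -> exists c, f = c *: psi.
Proof.
elim: k f => [f /= ->|k IHk f]; first by exists 0; rewrite scale0r.
rewrite iterSr => /IHk[c Lfc]; have {Lfc} Lf : L f = l *: f + c *: psi.
  by rewrite -Lfc addrC subrK.
have iterf n : iter n L f = l ^+ n *: (f + (n%:R * (c / l)) *: psi).
  elim: n => [|n IHn]; first by rewrite mul0r scale0r addr0 scale1r.
  rewrite iterS IHn linearZ linearD linearZ/= Lpsi Lf exprSr -[RHS]scalerA.
  congr (_ *: _); rewrite scalerDr -addrA; congr (_ + _).
  rewrite !scalerA -scalerDl; congr (_ *: _).
  rewrite -natr1 mulrDl mul1r mulrDr [l * (c / l)]mulrC divfK ?gt_eqF//.
  by rewrite addrC mulrC.
have [B B0 LB] := iter_ruelle_bound.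
suff c0 : c = 0 by apply: eigenspace_line; rewrite Lf c0 scale0r addr0.
have [//|cn0] := eqVneq c 0.
pose q := `|c / l| * `|psi|.
have q0 : 0 < q.
  apply: mulr_gt0; rewrite normr_gt0.
    by rewrite mulf_neq0// invr_eq0 gt_eqF.
  apply/negP => /eqP p0; have := psi0 point; rewrite p0.
  by rewrite -[(0 : C) point]/0 ltxx.
have bd n : n%:R * q <= (B + 1) * `|f|.
  have := LB n f; rewrite iterf normrZ ger0_norm ?exprn_ge0 ?(ltW l0)//.
  rewrite (mulrC B) -mulrA ler_pM2l ?exprn_gt0// => le1.
  have -> : n%:R * q = `|(n%:R * (c / l)) *: psi|.
    by rewrite normrZ normrM normr_nat /q mulrA.
  rewrite -(addKr f ((_ * _) *: psi)) addrC mulrDl mul1r.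
  by apply: le_trans (ler_normD _ _) _; rewrite normrN lerD2r.
have := bd (Num.bound ((B + 1) * `|f| / q)); rewrite leNgt => /negP[].
rewrite -ltr_pdivrMr//; apply: archi_boundP.
by rewrite divr_ge0 ?(ltW q0)// mulr_ge0// addr_ge0.
Qed.

End Uniqueness.

(** * Completeness of the space of continuous functions *)

Section Completeness.
Context (R : realType) (T : compactMetricType R).
Local Notation C := (continuousType T R).

(** The limit is the pointwise limit of the filter; it is continuous because a
    single member of the filter is uniformly close to it. *)
Lemma continuousType_complete (F : set_system C) :
  ProperFilter F -> cauchy F -> cvg F.
Proof.
move=> FF /cauchyP FC.
have FE e : 0 < e -> exists2 f : C, F (ball f e) & forall x g, ball f e g ->
    `|f x - g x| <= e.
  move=> /FC[f Ff]; exists f => // x g fg; apply: ltW; move: fg.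
  by rewrite -ball_normE/=; apply: le_lt_trans; exact: (supnorm_ge (f - g) x).
pose ev x : set_system R := (fun f : C => f x) @ F.
have evP x : ProperFilter (ev x) by exact: fmap_proper_filter.
have evc x : ev x --> lim (ev x).
  apply: cauchy_cvg; apply: cauchy_exP => e e0.
  have e20 : 0 < e / 2 by rewrite divr_gt0.
  have [f Ff fP] := FE _ e20.
  exists (f x); suff: F (fun g : C => ball (f x) e (g x)) by [].
  apply: filterS Ff => g /(fP x) fg.
  rewrite -ball_normE/=; apply: le_lt_trans fg _.
  by rewrite ltr_pdivrMr// ltr_pMr// ltr1n.
pose h x : R := lim (ev x).
have hP e f : F (ball f e) -> (forall x g, ball f e g -> `|f x - g x| <= e) ->
    forall x, `|f x - h x| <= e.
  move=> Ff fP x; rewrite ler_distlC; apply/andP; split.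
    apply: (limr_ge (evc x)).
    by apply: filterS Ff => g /(fP x); rewrite ler_distlC => /andP[].
  apply: (limr_le (evc x)).
  by apply: filterS Ff => g /(fP x); rewrite ler_distlC => /andP[].
have ch : continuous h.
  move=> x; apply/cvgrPdist_le => e e0.
  have e30 : 0 < e / 3 by rewrite divr_gt0.
  have [f Ff fP] := FE _ e30; have fh := hP _ _ Ff fP.
  have /cvgrPdist_le/(_ _ e30) := @cts_fun _ _ f x.
  apply: filterS => y fxy; have := fh x; have := fh y; move: fxy.
  rewrite !ler_norml => /andP[? ?] /andP[? ?] /andP[? ?]; lra.
apply/cvg_ex; exists (mkcts ch : C); apply/cvgrPdist_le => e e0.
have e20 : 0 < e / 2 by rewrite divr_gt0.
have [f Ff fP] := FE _ e20; have fh := hP _ _ Ff fP.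
apply: filterS Ff => g fg; apply: supnorm_le => x.
rewrite -[X in `|X|]/(h x - g x); have := fh x; have := fP x g fg.
rewrite !ler_norml => /andP[? ?] /andP[? ?]; lra.
Qed.

HB.instance Definition _ := Uniform_isComplete.Build C continuousType_complete.

End Completeness.

(** * Neumann series on the complexification *)

Section GeometricSeries.
Context {R : realType} {V : completeNormedModType R}.

Lemma geometrically_bounded_series (u : nat -> V) (k q : R) :
  0 <= q < 1 -> (forall n, `|u n| <= k * q ^+ n) ->
  series u @ \oo --> limn (series u) /\ `|limn (series u)| <= k / (1 - q).
Proof.
move=> /andP[q0 q1] uk; have q1' : `|q| < 1 by rewrite ger0_norm.
have k0 : 0 <= k.
  by have := le_trans (normr_ge0 _) (uk 0%N); rewrite expr0 mulr1.
have gc : cvgn (series (geometric k q)) by exact: is_cvg_geometric_series.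
have nc : cvgn [normed series u].
  apply: (series_le_cvg _ _ _ gc) => n; [exact: normr_ge0| |exact: uk].
  exact: geometric_ge0.
split; first exact: normed_cvg nc.
apply: le_trans (lim_series_norm nc) _.
rewrite -(cvg_lim _ (cvg_geometric_series q1'))//.
exact: lim_series_le.
Qed.

End GeometricSeries.

Section Neumann.
Context {R : realType} {V : completeNormedModType R} (T : {linear V -> V}).
Implicit Types (z : R[i]) (v w : V * V).

(** The space [V * V] is handled as a real space with a complex structure J, so
    that complex scalars act through [act]. *)
Let J w : V * V := (- w.2, w.1).
Let cT w : V * V := (T w.1, T w.2).
Let act z w : V * V := complex.Re z *: w + complex.Im z *: J w.
Let shift z w := complexified_shift T z w.

Let pairP v w : v.1 = w.1 -> v.2 = w.2 -> v = w.
Proof. by case: v w => ? ? [? ?] /= -> ->. Qed.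

Let shiftE z w : shift z w = act z w - cT w.
Proof. by apply: pairP; rewrite /= ?scalerN. Qed.

Let JD v w : J (v + w) = J v + J w.
Proof. by apply: pairP => //=; rewrite opprD. Qed.

Let JZ (a : R) w : J (a *: w) = a *: J w.
Proof. by apply: pairP => //=; rewrite scalerN. Qed.

Let JJ w : J (J w) = - w. Proof. exact: pairP. Qed.

Let cTD v w : cT (v + w) = cT v + cT w.
Proof. by apply: pairP; rewrite /= linearD. Qed.

Let cT_act z w : cT (act z w) = act z (cT w).
Proof. by apply: pairP; rewrite /= linearD !linearZ//= linearN. Qed.

Let actD z v w : act z (v + w) = act z v + act z w.
Proof. by rewrite /act JD !scalerDr addrACA. Qed.

Let act1 w : act 1 w = w.
Proof. by rewrite /act /= scale1r scale0r addr0. Qed.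

Let actM z z' w : act (z * z') w = act z (act z' w).
Proof.
case: z z' => [a b] [a' b']; rewrite /act/= !JD !JZ JJ.
rewrite !scalerDr !scalerA scalerN scalerDl scaleNr scalerDl.
by rewrite addrACA [X in _ + X]addrC.
Qed.

Let act_norm z w : `|act z w| <= 2 * Normc.normc z * `|w|.
Proof.
have nRe : `|complex.Re z| <= Normc.normc z.
  case: z => a b /=; rewrite -sqrtr_sqr ler_sqrt ?lerDl ?sqr_ge0//.
  by rewrite addr_ge0 ?sqr_ge0.
have nIm : `|complex.Im z| <= Normc.normc z.
  case: z {nRe} => a b /=; rewrite -sqrtr_sqr ler_sqrt ?lerDr ?sqr_ge0//.
  by rewrite addr_ge0 ?sqr_ge0.
have nJ : `|J w| = `|w| by rewrite !prod_normE/= normrN maxC.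
apply: le_trans (ler_normD _ _) _; rewrite !normrZ nJ -mulrA mulr_natl mulr2n.
by rewrite lerD// ler_wpM2r.
Qed.

Context (B l : R) (B0 : 0 <= B) (l0 : 0 <= l).
Hypothesis TB : forall n (x : V), `|iter n T x| <= B * l ^+ n * `|x|.

Let cT_norm n w : `|iter n cT w| <= B * l ^+ n * `|w|.
Proof.
have -> : iter n cT w = (iter n T w.1, iter n T w.2).
  by elim: n => [|n /= ->]; [case: w|].
rewrite !prod_normE/= ge_max; apply/andP; split; apply: le_trans (TB _ _) _.
  by rewrite ler_wpM2l ?mulr_ge0 ?exprn_ge0// le_max lexx.
by rewrite ler_wpM2l ?mulr_ge0 ?exprn_ge0// le_max lexx orbT.
Qed.

Context z (lz : l < Normc.normc z).

Let r := Normc.normc z.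
Let r0 : 0 < r. Proof. exact: le_lt_trans lz. Qed.
Let z0 : z != 0.
Proof. by apply: contraTneq r0 => z0; rewrite /r z0 Normc.normc0 ltxx. Qed.
Let q := l / r.
Let q01 : 0 <= q < 1.
Proof. by rewrite /q divr_ge0 ?(ltW r0)//= ltr_pdivrMr// mul1r. Qed.

(** [z^(-n) T^n w], the residual that the n-th partial sum of the
    Neumann series leaves in the equation [(z - T) s = w]. *)
Let rem n w := act (z^-1 ^+ n) (iter n cT w).

Let normcX n : Normc.normc (z^-1 ^+ n) = r^-1 ^+ n.
Proof.
elim: n => [|n IHn]; first by rewrite !expr0 Normc.normc1.
by rewrite !exprS Normc.normcM IHn Normc.normcV.
Qed.

Let rem_norm n w : `|rem n w| <= 2 * B * `|w| * q ^+ n.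
Proof.
apply: le_trans (act_norm _ _) _; rewrite normcX.
apply: le_trans (ler_wpM2l _ (cT_norm n w)) _.
  by rewrite mulr_ge0// exprn_ge0// invr_ge0 ltW.
by rewrite /q exprMn le_eqVlt; apply/orP; left; apply/eqP; ring.
Qed.

Let rem_cvg0 w : (fun n => rem n w) @ \oo --> (0 : V * V).
Proof.
have [q0 q1] := andP q01.
apply/cvgrPdist_le => e e0.
have : (fun n => 2 * B * `|w| * q ^+ n) @ \oo --> (0 : R).
  by apply: cvg_geometric; rewrite ger0_norm.
move=> /cvgrPdist_le/(_ _ e0); apply: filterS => n.
rewrite !sub0r !normrN; apply: le_trans; apply: le_trans (rem_norm n w) _.
exact: ler_norm.
Qed.

Let term w n := act z^-1 (rem n w).

Let shift_term w n : shift z (term w n) = rem n w - rem n.+1 w.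
Proof.
rewrite shiftE /term -actM divff// act1 cT_act; congr (_ - _).
by rewrite /rem cT_act -actM exprS -iterS.
Qed.

Let shiftD v w : shift z (v + w) = shift z v + shift z w.
Proof. by rewrite !shiftE actD cTD opprD addrACA. Qed.

Let shift0 : shift z 0 = 0.
Proof. by apply: (addIr (shift z 0)); rewrite -shiftD !add0r. Qed.

(** The Neumann sum telescopes. *)
Let shift_series w n : shift z (series (term w) n) = w - rem n w.
Proof.
rewrite seriesEnat/=; elim: n => [|n IHn].
  by rewrite big_geq// shift0 /rem expr0 act1 subrr.
by rewrite big_nat_recr//= shiftD IHn shift_term addrA subrK.
Qed.

Let term_norm w n : `|term w n| <= 2 * r^-1 * (2 * B * `|w|) * q ^+ n.
Proof.
apply: le_trans (act_norm _ _) _; rewrite Normc.normcV -[leRHS]mulrA.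
by rewrite ler_wpM2l ?mulr_ge0 ?invr_ge0 ?(ltW r0)// rem_norm.
Qed.

Let S w : V * V := (limn (series (fun n => (term w n).1)),
                    limn (series (fun n => (term w n).2))).

Let term_norm1 w n : `|(term w n).1| <= 2 * r^-1 * (2 * B * `|w|) * q ^+ n.
Proof. by apply: le_trans (term_norm w n); rewrite prod_normE le_max lexx. Qed.

Let term_norm2 w n : `|(term w n).2| <= 2 * r^-1 * (2 * B * `|w|) * q ^+ n.
Proof.
by apply: le_trans (term_norm w n); rewrite prod_normE le_max lexx orbT.
Qed.

Let S_cvg w : series (term w) @ \oo --> S w.
Proof.
have [c1 _] := geometrically_bounded_series q01 (term_norm1 w).
have [c2 _] := geometrically_bounded_series q01 (term_norm2 w).
have -> : series (term w) = fun n => (series (fun n => (term w n).1) n,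
                                      series (fun n => (term w n).2) n).
  apply/funext => n; rewrite !seriesEnat/=.
  by elim: n => [|n IHn]; [rewrite !big_geq|rewrite !big_nat_recr//= IHn].
exact: cvg_pair c1 c2.
Qed.

Let shiftB v w : shift z (v - w) = shift z v - shift z w.
Proof. by apply/eqP; rewrite eq_sym subr_eq -shiftD subrK. Qed.

Let shift_continuous : continuous (shift z).
Proof.
move=> w; apply/cvgrPdist_le => e e0; pose k := 2 * r + B * l.
have k0 : 0 < k by rewrite ltr_pwDl ?mulr_ge0// mulr_gt0.
have : \forall v \near w, `|w - v| <= e / k.
  apply: (@cvgr_dist_le _ _ _ (nbhs w) _ id w); first exact: cvg_id.
  by rewrite divr_gt0.
apply: filterS => v; rewrite ler_pdivlMr// => wv; rewrite -shiftB shiftE.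
apply: le_trans (ler_normB _ _) _; apply: le_trans wv.
rewrite mulrC mulrDl lerD ?act_norm//.
by apply: le_trans (cT_norm 1 _) _; rewrite expr1.
Qed.

(** If [z u = T u] then [u = z^(-n) T^n u] for every n, and this tends to 0. *)
Let shift_inj : injective (shift z).
Proof.
move=> v w /eqP; rewrite -subr_eq0 -shiftB shiftE subr_eq0 => /eqP vw.
apply/eqP; rewrite -subr_eq0; apply/eqP; move: (v - w) vw => u zu.
have iteru n : iter n cT u = act (z ^+ n) u.
  elim: n => [|n IHn]; first by rewrite act1.
  by rewrite iterS IHn cT_act -zu -actM exprSr.
have remu : (fun n => rem n u) = fun=> u.
  apply/funext => n; rewrite /rem iteru -actM -exprMn mulVf//.
  by rewrite expr1n act1.
have := rem_cvg0 u; rewrite remu => u0.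
exact: (cvg_unique _ (cvg_cst u) u0).
Qed.

(** The inverse of [z - T] is the Neumann series S; its norm is bounded by
    that of the dominating geometric series. *)
Lemma resolvent_set_power_bounded : resolvent_set T z.
Proof.
have shiftK : cancel S (shift z).
  move=> w.
  have c1 : (fun n => shift z (series (term w) n)) @ \oo --> shift z (S w).
    exact: (continuous_cvg _ (@shift_continuous (S w)) (@S_cvg w)).
  have c2 : (fun n => w - rem n w) @ \oo --> w - 0.
    exact: (cvgB (cvg_cst w) (rem_cvg0 w)).
  move: c1; under eq_fun do rewrite shift_series; rewrite -[RHS]subr0 => c1.
  exact: (cvg_unique _ c1 c2).
exists S; split => //; first exact: inj_can_sym shiftK shift_inj.
exists (2 / r * (2 * B) / (1 - q)) => w.
have [_ n1] := geometrically_bounded_series q01 (term_norm1 w).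
have [_ n2] := geometrically_bounded_series q01 (term_norm2 w).
have kE : 2 / r * (2 * B * `|w|) / (1 - q) = 2 / r * (2 * B) / (1 - q) * `|w|.
  by ring.
by rewrite prod_normE ge_max -kE n1 n2.
Qed.

End Neumann.

Lemma spectral_radius_eigenvalue (R : realType) (V : completeNormedModType R)
    (T : {linear V -> V}) (B l : R) (v : V) : 0 <= B -> 0 <= l ->
  (forall n x, `|iter n T x| <= B * l ^+ n * `|x|) ->
  eigenvector T l v -> spectral_radius T = l.
Proof.
move=> B0 l0 TB [v0 Tv].
have ub : ubound [set Normc.normc z | z in spectrum T] l.
  move=> _ [z sz <-]; rewrite leNgt; apply/negP => lz; apply: sz.
  exact: (resolvent_set_power_bounded B0 l0 TB lz).
have lS : [set Normc.normc z | z in spectrum T] l.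
  exists l%:C%C; last by rewrite /= expr0n addr0 sqrtr_sqr ger0_norm.
  move=> [S [SK _ _]].
  (* the eigenvector, as a real vector of the complexification, is killed *)
  have sv : complexified_shift T l%:C%C (v, 0) = complexified_shift T l%:C%C 0.
    rewrite /complexified_shift /= Tv.
    by rewrite !scaler0 !scale0r !linear0 !addr0 subrr.
  by have := congr1 S sv; rewrite !SK => -[/eqP]; rewrite (negbTE v0).
apply/eqP; rewrite eq_le; apply/andP; split.
  by apply: ge_sup => //; exists l.
by apply: sup_upper_bound => //; split; exists l.
Qed.

(** * The leading eigenvalue of the Ruelle operator *)

Theorem theorem3 (R : realType) (M : compactMetricType R)
    (connectedM : connected [set: M])
    (n : nat) (g : riemannian R M n)
    (da : probability (borel M) R) (volume_da : is_normalized_volume g da)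
    (A : seqspace M -> R) (lipA : metric_lipschitz A) :
  let L := ruelle da (mkcts (metric_lipschitz_continuous lipA)) in
  exists (psi : continuousType (seqspace M) R) (lambda : R),
    [/\ metric_lipschitz psi,
        (forall x, 0 < psi x),
        0 < lambda,
        L psi = lambda *: psi &
        simple_eigenvalue L lambda /\ spectral_radius L = lambda].
Proof.
move=> L; have [K0 AK0] := lipA; pose K : R := `|K0|.
pose cA : continuousType (seqspace M) R :=
  mkcts (metric_lipschitz_continuous lipA).
have K_ge0 : 0 <= K by exact: normr_ge0.
have AK x y : `|cA x - cA y| <= K * mdist x y.
  by apply: le_trans (AK0 x y) _; rewrite ler_wpM2r ?mdist_ge0// ler_norm.
have [psi [l [Kpsi psi0 l0 Lpsi]]] :=
  exists_positive_eigenfunction da K_ge0 AK.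
have psiE : eigenvector L l psi.
  split => //; apply/eqP => p0; have := psi0 point; rewrite p0.
  by rewrite -[X in _ < X]/0 ltxx.
exists psi, l; split => //.
  apply: (log_lipschitz_metric_lipschitz (b := supnorm psi) K_ge0 _ Kpsi) => x.
  apply/andP; split; first exact: ltW.
  exact: le_trans (ler_norm _) (supnorm_ge psi x).
split.
  exists psi => // k w.
  exact: (generalized_eigenspace_line K_ge0 AK psi0 l0 Lpsi).
have [B B0 LB] := iter_ruelle_bound psi0 l0 Lpsi.
exact: (spectral_radius_eigenvalue B0 (ltW l0) LB psiE).
Qed.
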